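(* Let $(X,\mu,W)$ be a path-connected topological design problem, with associated quantities $M$ and $K$. If $M>0$, then for every integer $N>(M-1)(K+1)$ there exists a design of size $N$ for this design problem.
   Context: A topological design problem is a triple $(X,\mu,W)$ where $X$ is a topological space with its Borel $\sigma$-algebra, $\mu$ is a positive measure on it with $\mu(X)=1$, and $W$ is a finite-dimensional real vector space of bounded continuous functions $X\to\mathbb{R}$. It is path-connected if $X$ is a path-connected topological space. A design of size $N$ is a list of $N$ points $p_1,\dots,p_N\in X$ (not necessarily distinct) with $\int_X f\,d\mu=\frac1N\sum_{i=1}^N f(p_i)$ for all $f\in W$. Let $V$ be the space of all $f\in W+\langle 1\rangle$ (where $1$ is the constant function) with $\int_X f\,d\mu=0$, let $M=\dim V$, and let $$K=\sup_{f\in V\setminus\{0\}}\frac{\sup(f)}{|\inf(f)|}=\sup_{f\in V\setminus\{0\}}\frac{\sup(|f|)}{\sup(f)}.$$ *)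

(* Defs.v *)
From mathcomp Require Import all_boot all_order all_algebra.
From mathcomp Require Import all_classical all_reals all_analysis.

Set Implicit Arguments.
Unset Strict Implicit.
Unset Printing Implicit Defensive.

Import Order.TTheory GRing.Theory Num.Theory.
Import numFieldNormedType.Exports.

Local Open Scope classical_set_scope.
Local Open Scope ring_scope.

(* The base point of a ptopologicalType is never used: it is there because the
   library builds g_sigma_algebraType on pointed types only, and a space
   carrying a probability measure is nonempty anyway. *)
Notation borelType X := (g_sigma_algebraType (@open X)).

Definition path_connected (R : realType) (X : topologicalType) : Prop :=
  forall x y : X, exists gamma : R -> X,
    [/\ {within `[0, 1], continuous gamma}, gamma 0 = x & gamma 1 = y].

Section FiniteDimension.
Context {R : realType} {E : lmodType R}.

(* [has_dim U n] reads "U is a linear subspace of E, of dimension n", where E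
   itself may be infinite-dimensional. *)
Definition has_dim (U : set E) (n : nat) : Prop :=
  submod_closed (mem U) /\
  exists b : 'I_n -> E,
    [/\ forall i, U (b i),
        forall c : 'I_n -> R, \sum_i c i *: b i = 0 -> forall i, c i = 0
      & forall f, U f -> exists c : 'I_n -> R, f = \sum_i c i *: b i].

End FiniteDimension.

(* Functions take values in R^o, i.e. R seen as a vector space over itself, so
   that X -> R^o carries the pointwise vector space structure. *)
Record design_space (R : realType) (X : ptopologicalType)
    (W : set (X -> R^o)) : Prop := DesignSpace {
  design_space_fin_dim : exists n, has_dim W n ;
  design_space_continuous : forall f, W f -> continuous f ;
  design_space_bounded : forall f, W f -> bounded_fun f }.

Section DesignProblem.
Context {R : realType} {X : ptopologicalType}.
Variables (mu : probability (borelType X) R) (W : set (X -> R^o)).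

Definition is_design (N : nat) (p : 'I_N -> X) : Prop :=
  forall f, W f ->
    (\int[mu]_x (f x)%:E)%E = (N%:R^-1 * \sum_(i < N) f (p i))%:E.

Definition mean_zero_space : set (X -> R^o) :=
  [set f | (exists2 w, W w & exists c : R, f = w + cst c) /\
           (\int[mu]_x (f x)%:E = 0)%E].

(* The supremum is taken in the extended reals, where the library sets
   0^-1 = +oo: when inf f = 0 for some nonzero f in V (possible only if mu
   vanishes on a nonempty open set), sup f > 0 and the constant is +oo. *)
Definition design_constant : \bar R :=
  ereal_sup [set (ereal_sup [set (f x)%:E | x in [set: X]]
                  / `|ereal_inf [set (f x)%:E | x in [set: X]]|)%E
            | f in mean_zero_space `\ 0].

End DesignProblem.

(* Main.v *)
(* Identify f in V with its coordinates c in the cube [-1, 1]^M. Triangulate the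
   cube finely and choose for every vertex v a point y_v where the function v
   almost attains its supremum. The barycentric weights of c, cut into N parts,
   tell which y_v each of the N points p_1(c), ..., p_N(c) sits at, or which
   paths from a base point to the y_v it is travelling on. On the boundary of
   the cube at most M weights are nonzero, so at most M - 1 points are
   travelling, and N > (M - 1)(K + 1) makes the sum of c over p_1(c), ..., p_N(c)
   positive. The map sending c to the functional "sum over p_1(c), ..., p_N(c)"
   thus points outward on the boundary, hence vanishes somewhere, by the
   Poincare-Miranda theorem. The latter is derived from a discrete version:
   over F_2, the cup product of the coboundaries of n labellings of the grid,
   the i-th of which is 0 and 1 on the i-th opposite facets, sums up to 1, so
   in some grid cell all n labellings are nonconstant. *)

Require Import Defs.
From mathcomp Require Import all_boot all_order all_algebra.
From mathcomp Require Import all_classical all_reals all_analysis.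
From mathcomp Require Import ring lra measurable_realfun.

Set Implicit Arguments.
Unset Strict Implicit.
Unset Printing Implicit Defensive.

Import Order.TTheory GRing.Theory Num.Theory.
Import numFieldNormedType.Exports.

Local Open Scope classical_set_scope.
Local Open Scope ring_scope.

(** * A cubical Sperner lemma *)

Section Kuhn.
Variables n p : nat.
Local Notation grid := {ffun 'I_n -> 'I_p.+1}.
Variable g : 'I_n -> grid -> 'F_2.
Implicit Types (A : {set 'I_n}) (s : seq 'I_n) (y z : grid).

(** At [y a = p] the successor is out of range and [inord] returns 0, so [step] wraps around; it
    follows an edge of the grid only when [y a < p]. *)
Definition step (a : 'I_n) y : grid :=
  [ffun i => if i == a then inord (y a).+1 else y i].

(* The coefficient on the unit cube spanned at y by the directions in A of the
   cup product over F_2 of the coboundaries of the g i, i in s: a sum over monotone edge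
   paths in the cube. *)
Fixpoint cup s A y : 'F_2 :=
  if s is i :: s' then
    \sum_(a in A) (g i (step a y) + g i y) * cup s' (A :\ a) (step a y)
  else 1.

Let F2dbl (x : 'F_2) : x + x = 0.
Proof. exact: addrr_pchar2 (pchar_Fp _) x. Qed.

(** The pairs [(a, b)] and [(b, a)] contribute equal values, which cancel in characteristic 2. *)
Lemma sum_pairs_F2 (A : {set 'I_n}) (F : 'I_n -> 'I_n -> 'F_2) :
  (forall a b, F a b = F b a) ->
  \sum_(a in A) \sum_(b in A :\ a) F a b = 0.
Proof.
move=> Fsym; pose P (a b : 'I_n) := (a \in A) && (b \in A).
have -> : \sum_(a in A) \sum_(b in A :\ a) F a b =
    \sum_(a in A) \sum_(b in A | (a < b)%N) F a b +
    \sum_(a in A) \sum_(b in A | (b < a)%N) F a b.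
  rewrite -big_split /=; apply: eq_bigr => a aA.
  rewrite (bigID (fun b : 'I_n => (a < b)%N)) /=; congr (_ + _); apply: eq_bigl => b.
    by rewrite !inE; case: (ltngtP a b) => [h|h|/val_inj->]; rewrite ?andbF//=
      ?andbT -(inj_eq val_inj) /= ?(gtn_eqF h).
  rewrite !inE -(inj_eq val_inj) /=.
  by case: (ltngtP a b) => h; rewrite ?andbF//= ?andbT.
rewrite [X in _ + X](exchange_big_dep (mem A)) /=; last by move=> a b _ /andP[].
rewrite -[X in _ + X](eq_bigr _ (fun=> fun=> erefl)).
rewrite -big_split big1 //= => a aA.
rewrite [X in _ + X](_ : _ = \sum_(b in A | (a < b)%N) F a b) ?F2dbl//.
by apply: eq_big => [b|b _]; [rewrite aA | exact: Fsym].
Qed.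

Lemma stepC a b y : b != a -> step a (step b y) = step b (step a y).
Proof.
move=> ba; apply/ffunP => i; rewrite !ffunE.
by case: (eqVneq i a) => [->|ia]; case: (eqVneq i b) => [ib|ib];
  rewrite ?ib ?eqxx ?(negPf ba) 1?eq_sym ?(negPf ba) ?eqxx //;
  move: ba; rewrite ib eqxx.
Qed.

(* A cup product of coboundaries is a cocycle. *)
Lemma cup_closed s A y :
  \sum_(a in A) (cup s (A :\ a) (step a y) + cup s (A :\ a) y) = 0.
Proof.
elim: s A y => [|k s IH] A y /=; first by rewrite big1 // => a _; rewrite F2dbl.
have IH' (B : {set 'I_n}) z : \sum_(a in B) cup s (B :\ a) (step a z) =
               \sum_(a in B) cup s (B :\ a) z.
  by apply/eqP; rewrite -[_ == _]subr_eq0 (oppr_pchar2 (pchar_Fp _))// -big_split IH.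
have setDC a b : A :\ a :\ b = A :\ b :\ a by rewrite finset.setDDl finset.setUC -finset.setDDl.
pose F a b := cup s (A :\ a :\ b).
have FC a b : F a b = F b a by rewrite /F setDC.
rewrite big_split /=.
(* The terms with [g k (step b (step a y))] are symmetric in [a] and [b] and cancel; in the others
   the induction hypothesis undoes the step along [b]. *)
have -> : \sum_(a in A) \sum_(b in A :\ a) (g k (step b (step a y)) + g k (step a y)) *
     F a b (step b (step a y)) =
    \sum_(a in A) \sum_(b in A :\ a) g k (step a y) * F a b (step a y).
  transitivity (\sum_(a in A) \sum_(b in A :\ a)
        g k (step b (step a y)) * F a b (step b (step a y)) +
      \sum_(a in A) \sum_(b in A :\ a) g k (step a y) * F a b (step b (step a y))).
    rewrite -big_split; apply: eq_bigr => a _ /=; rewrite -big_split.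
    by apply: eq_bigr => b _ /=; rewrite mulrDl.
  rewrite sum_pairs_F2 ?add0r; last first.
    by move=> a b; rewrite FC; case: (eqVneq a b) => [->|ab] //; rewrite stepC.
  by apply: eq_bigr => a _; rewrite -!mulr_sumr; congr (_ * _); exact: IH'.
have -> : \sum_(a in A) \sum_(b in A :\ a) (g k (step b y) + g k y) * F a b (step b y) =
    \sum_(a in A) \sum_(b in A :\ a) (g k (step a y) + g k y) * F a b (step a y).
  rewrite (exchange_big_dep (mem A)) /=; last by move=> a b _; rewrite !inE => /andP[].
  apply: eq_bigr => a aA; apply: eq_big => [b|b _]; last by rewrite FC.
  by rewrite !inE aA andbT eq_sym andbC.
rewrite -big_split /=.
(* The terms with [g k (step a y)] now occur twice. What is left becomes symmetric by the induction
   hypothesis, hence vanishes. *)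
transitivity (g k y * \sum_(b in A) \sum_(a in A :\ b) F a b (step a y)).
  rewrite mulr_sumr.
  transitivity (\sum_(a in A) \sum_(b in A :\ a) g k y * F a b (step a y)).
    apply: eq_bigr => a _; rewrite -big_split; apply: eq_bigr => b _ /=.
    by rewrite mulrDl addrA F2dbl add0r.
  rewrite (exchange_big_dep (mem A)) /=; last by move=> a b _; rewrite !inE => /andP[].
  apply: eq_bigr => a aA; rewrite mulr_sumr; apply: eq_bigl => b.
  by rewrite !inE aA andbT eq_sym andbC.
rewrite (eq_bigr (fun b => \sum_(a in A :\ b) F b a y)); last first.
  move=> b _; rewrite -(IH' (A :\ b) y); apply: eq_bigr => a _; by rewrite FC.
by rewrite sum_pairs_F2 ?mulr0 // => a b; rewrite FC.
Qed.

Definition in_cube A y z :=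
  forall i, z i = y i :> nat \/ i \in A /\ z i = (y i).+1 :> nat.

(** A nonzero cup product has a nonzero term: a monotone edge path in the cube, each [g i] with [i]
    in [s] changing along one of its edges. *)
Lemma cup_neq0 s A y i :
  (forall a, a \in A -> (y a < p)%N) -> cup s A y != 0 ->
  i \in s -> exists z z', [/\ in_cube A y z, in_cube A y z' & g i z != g i z'].
Proof.
elim: s A y => [//|k s IH] A y yA /= cn0; rewrite in_cons => /predU1P ik.
have [a aA an0] : exists2 a, a \in A &
    (g k (step a y) + g k y) * cup s (A :\ a) (step a y) != 0.
  apply: contrapT => H; move/eqP: cn0; apply; apply: big1 => a aA.
  by apply/eqP/negPn/negP => an0; apply: H; exists a.
have stepa j : step a y j = (if j == a then (y j).+1 else y j) :> nat.
  rewrite ffunE; case: eqVneq => [->|//]; rewrite inordK// ltnS; exact: yA.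
case: ik => [->|iins].
  exists (step a y), y; split.
  - by move=> j; rewrite stepa; case: eqVneq => [->|_]; [right|left].
  - by move=> j; left.
  - apply: contra_neq an0 => ->; by rewrite F2dbl mul0r.
have [||z [z' [zc zc' gzz']]] := IH (A :\ a) (step a y) _ _ iins.
- move=> b; rewrite !inE => /andP[ba bA]; rewrite stepa (negPf ba); exact: yA.
- by apply: contra_neq an0 => ->; rewrite mulr0.
have sub w : in_cube (A :\ a) (step a y) w -> in_cube A y w.
  move=> wc j; have := wc j; rewrite stepa !inE; case: eqVneq => [->|ia] /=.
    by case=> [->|[]//]; right.
  by case=> [->|[jA ->]]; [left|right].
by exists z, z'; split => //; exact: sub.
Qed.

(** Lower corners of the unit cubes with directions [A] in the face of the grid where the
    coordinates outside [A] equal [p]. *)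
Definition box (A : {set 'I_n}) : pred grid :=
  [pred y : grid | [forall i, (y i < p)%N == (i \in A)]].

(** On every grid line in direction [a] the sum telescopes to the values at the two ends. *)
Lemma sum_box_telescope A a (F : grid -> 'F_2) : a \in A ->
  \sum_(y in box A) (F (step a y) + F y) =
  \sum_(y in box (A :\ a)) (F y + F [ffun i => if i == a then ord0 else y i]).
Proof.
move=> aA.
pose D := [pred y : grid | [forall i, (i != a) ==> ((y i < p)%N == (i \in A))]].
have boxA y : (y \in box A) = (y \in D) && (y a != p :> nat).
  rewrite !inE; apply/forallP/andP => [H|[/forallP H ya] i].
    split; first by apply/forallP => i; rewrite (eqP (H i)) eqxx implybT.
    by rewrite neq_ltn (eqP (H a)) aA.
  case: (eqVneq i a) => [->|ia]; last by have := H i; rewrite ia.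
  by rewrite aA eqb_id ltn_neqAle ya -ltnS ltn_ord.
have boxAa y : (y \in box (A :\ a)) = (y \in D) && (y a == p :> nat).
  rewrite !inE; apply/forallP/andP => [H|[/forallP H ya] i].
    split; first by apply/forallP => i; apply/implyP => ia;
      rewrite (eqP (H i)) !inE ia.
    have := H a; rewrite !inE eqxx /= eqbF_neg -leqNgt => pa.
    by rewrite eqn_leq pa -ltnS ltn_ord.
  rewrite !inE; case: (eqVneq i a) => [->|ia] /=; last by have := H i; rewrite ia.
  by rewrite (eqP ya) ltnn.
rewrite !big_split /= [X in _ + X = _](eq_bigl _ _ boxA).
rewrite [X in _ = X + _](eq_bigl _ _ boxAa).
rewrite [X in X + _ = _](_ : _ = \sum_(y in D | y a != ord0) F y); last first.
  pose back (y : grid) : grid := [ffun i => if i == a then inord (y a).-1 else y i].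
  rewrite [RHS](reindex_onto (step a) back) /=; last first.
    move=> y /andP[_ ya]; apply/ffunP => i; rewrite !ffunE eqxx.
    case: eqVneq => [->|//]; rewrite inordK ?(leq_ltn_trans (leq_pred _)) //.
    by rewrite prednK ?inord_val // lt0n; apply: contra_neq ya => ya; exact: val_inj.
  apply: eq_bigl => y; rewrite boxA.
  have -> : (step a y \in D) = (y \in D).
    rewrite !inE; apply: eq_forallb => i; rewrite ffunE; by case: eqVneq.
  case: (y \in D) => //=; apply/idP/andP => [ya|[]].
    have ya' : (y a < p)%N by rewrite ltn_neqAle ya -ltnS ltn_ord.
    split; first by rewrite -(inj_eq val_inj) ffunE eqxx /= inordK.
    apply/eqP/ffunP => i; rewrite !ffunE eqxx; case: eqVneq => [->|//].
    by rewrite inordK //= inord_val.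
  move=> sa /eqP/(congr1 (fun f : grid => f a)); rewrite !ffunE eqxx => yE.
  apply/negP => /eqP yp; move: sa; rewrite -(inj_eq val_inj) ffunE eqxx /= => /negP.
  rewrite /inord /insubd insubF /=; last by rewrite yp ltnn.
  by apply; rewrite eqxx.
rewrite [X in _ = _ + X](_ : _ = \sum_(y in D | y a == ord0) F y); last first.
  pose top (y : grid) : grid := [ffun i => if i == a then ord_max else y i].
  rewrite [RHS](reindex_onto (fun y => [ffun i => if i == a then ord0 else y i]) top) /=;
    last first.
    move=> y /andP[_ /eqP ya]; apply/ffunP => i; rewrite !ffunE.
    by case: eqVneq => [->|].
  apply: eq_bigl => y; rewrite boxAa.
  rewrite ffunE !eqxx andbT; congr andb.
    rewrite !inE; apply: eq_forallb => i; rewrite ffunE; by case: eqVneq.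
  apply/eqP/eqP => [ya|/ffunP/(_ a)].
    apply/ffunP => i; rewrite !ffunE; case: eqVneq => [->|//].
    by apply: val_inj.
  by rewrite !ffunE eqxx => <-.
(* Both sides of the premise will be the sum of [F] over [D], split according to [y a = 0] and to
   [y a = p]. *)
have addF2 (x x' z z' : 'F_2) : x + x' = z + z' -> x' + z' = z + x.
  move=> H; have : x + x' + (x + z') = z + z' + (x + z') by rewrite H.
  by rewrite addrACA F2dbl add0r addrACA [z' + z']F2dbl addr0.
apply: addF2; transitivity (\sum_(y in D) F y).
  by rewrite [RHS](bigID (fun y : grid => y a == ord0)).
by rewrite (bigID (fun y : grid => y a == p :> nat)).
Qed.

Hypothesis g_bot : forall i y, y i = ord0 -> g i y = 0.
Hypothesis g_top : forall i y, y i = ord_max -> g i y = 1.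

(** The cube lies in a facet on which [g a] is constant, whereas a nonzero cup product would make
    [g a] change inside it. *)
Lemma cup_face s A a y : a \in s -> a \notin A -> (forall b, b \in A -> (y b < p)%N) ->
  y a = ord0 \/ y a = ord_max -> cup s A y = 0.
Proof.
move=> ains aNA yA ya; apply/eqP/negPn/negP => /cup_neq0 - /(_ a yA ains).
case=> z [z' [zc zc' /eqP]]; apply.
have za w : in_cube A y w -> w a = y a.
  by move=> /(_ a) [/val_inj//|[aA]]; rewrite aA in aNA.
have {}za := (za _ zc, za _ zc').
by case: ya => ya; [rewrite !g_bot// za|rewrite !g_top// za].
Qed.

(* Discrete Stokes: the cup product is the coboundary of g k times the cup
   product over s, of which only the facet y k = p contributes. *)
Lemma sum_cup_box s : uniq s ->
  \sum_(y in box [set i in s]) cup s [set i in s] y = 1.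
Proof.
elim: s => [_|k s IH /= /andP[kNs us]].
  rewrite (big_pred1 [ffun=> ord_max]) // => y /=; rewrite inE.
  apply/forallP/eqP => [H|-> i]; last by rewrite ffunE ltnn !inE.
  apply/ffunP => i; rewrite ffunE; apply: val_inj; apply/eqP; rewrite /= eqn_leq -ltnS ltn_ord /=.
  by have := H i; rewrite !inE eqbF_neg -leqNgt.
set A := [set i in k :: s].
have Ak : A :\ k = [set i in s].
  by apply/setP => i; rewrite !inE; case: eqVneq => [->|]; rewrite ?(negPf kNs).
pose F a y := g k y * cup s (A :\ a) y.
(* Adding [g k y] times the cocycle relation turns the cup product into a coboundary. *)
transitivity (\sum_(a in A) \sum_(y in box A) (F a (step a y) + F a y)).
  rewrite [RHS]exchange_big; apply: eq_bigr => y _ /=.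
  have := congr1 ( *%R (g k y)) (cup_closed s A y); rewrite mulr0 mulr_sumr => H.
  rewrite [RHS](eq_bigr (fun a => (g k (step a y) + g k y) * cup s (A :\ a) (step a y) +
      g k y * (cup s (A :\ a) (step a y) + cup s (A :\ a) y))); last first.
    by move=> a _; rewrite /F mulrDl mulrDr -!addrA (addrA (g k y * _)) F2dbl add0r.
  by rewrite big_split /= H addr0.
have kA : k \in A by rewrite !inE eqxx.
(* In direction [k] the end [y k = p], where [g k] is 1, gives the sum for [s], and the end
   [y k = 0] gives 0. In another direction [a] both ends give 0, since [g a] is constant on each. *)
rewrite (bigD1 k) //= [X in _ + X]big1 ?addr0 => [|a /andP[aA ak]].
  rewrite sum_box_telescope // -[RHS](IH us) Ak; apply: eq_bigr => y.
  rewrite inE => /forallP /(_ k); rewrite !inE (negPf kNs) eqbF_neg -leqNgt => ky.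
  rewrite /F Ak g_top ?mul1r ?g_bot ?mul0r ?addr0 ?ffunE ?eqxx //.
  by apply: val_inj; apply/eqP; rewrite /= eqn_leq ky -ltnS ltn_ord.
have ains : a \in s by move: aA; rewrite !inE (negPf ak).
rewrite sum_box_telescope // big1 // => y; rewrite inE => /forallP ybox.
have yA b : b \in A :\ a -> (y b < p)%N by rewrite (eqP (ybox b)).
have aNA : a \notin A :\ a by rewrite !inE eqxx.
rewrite /F (cup_face ains aNA yA) ?(cup_face ains aNA) ?mulr0 ?addr0 //.
- by move=> b bA; rewrite ffunE; case: eqVneq bA => [->|_ /yA//]; rewrite !inE eqxx.
- by left; rewrite ffunE eqxx.
- right; apply: val_inj; apply/eqP; rewrite /= eqn_leq -ltnS ltn_ord /=.
  by have := ybox a; rewrite !inE eqxx eqbF_neg -leqNgt.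
Qed.

Lemma kuhn : exists y, (forall i, (y i < p)%N) /\
  forall i, exists z z', [/\ forall j, (y j <= z j <= (y j).+1)%N,
    forall j, (y j <= z' j <= (y j).+1)%N, g i z = 0 & g i z' = 1].
Proof.
pose T := finset.setTfor 'I_n; pose s := enum 'I_n.
have sT : [set i in s] = T by apply/setP => i; rewrite !inE mem_enum inE.
have [y ybox cn0] : exists2 y, y \in box T & cup s T y != 0.
  apply: contrapT => H; have := sum_cup_box (enum_uniq 'I_n); rewrite -/s sT big1 => [/eqP|y yb].
    by rewrite eq_sym oner_eq0.
  by apply/eqP/negPn/negP => yn0; apply: H; exists y.
have yp i : (y i < p)%N by move: ybox; rewrite inE => /forallP/(_ i); rewrite !inE eqb_id.
exists y; split => // i.
have i_s : i \in s by rewrite mem_enum.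
have [z [z' [zc zc' gzz']]] := cup_neq0 (fun a _ => yp a) cn0 i_s.
have cubeE w : in_cube T y w -> forall j, (y j <= w j <= (y j).+1)%N.
  by move=> wc j; case: (wc j) => [->|[_ ->]]; rewrite !leqnn !leqnSn.
move/cubeE: zc => zc; move/cubeE: zc' => zc'.
have F2E (x : 'F_2) : x = 0 \/ x = 1.
  by case: x => -[|[|//]] ?; [left|right]; apply: val_inj.
case: (F2E (g i z)) (F2E (g i z')) gzz' => gi [] gi'; rewrite gi gi' ?eqxx // => _.
- by exists z, z'; split => //.
- by exists z', z; split.
Qed.

End Kuhn.

(** * The Poincare-Miranda theorem *)

Section PoincareMiranda.
Context {R : realType} {n : nat}.
Implicit Types (x y z : 'rV[R]_n) (H : 'I_n -> 'rV[R]_n -> R).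

Definition cube : set 'rV[R]_n := [set x | forall i, -1 <= x 0 i <= 1].

Lemma cube_compact : compact cube.
Proof.
have := @rV_compact R n (fun=> `[-1, 1]%classic) (fun=> @segment_compact _ _ _).
rewrite (_ : [set v | _] = cube)//; apply/seteqP; split => x /= xc i;
  by have := xc i; rewrite in_itv.
Qed.

(** Cutting [[-1, 1]] into [p.+1] equal parts takes [p.+2] nodes, whence grid coordinates in
    ['I_p.+2]. *)
Definition mesh (p : nat) : R := 2 * p.+1%:R^-1.

Lemma mesh_gt0 p : 0 < mesh p.
Proof. by rewrite mulr_gt0 // invr_gt0 ltr0n. Qed.

Lemma mesh_width p : mesh p * p.+1%:R = 2.
Proof. by rewrite mulfVK // pnatr_eq0. Qed.

Definition grid_point p (v : {ffun 'I_n -> 'I_p.+2}) : 'rV[R]_n :=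
  \row_i (-1 + mesh p * (v i)%:R).

Lemma grid_point_cube p (v : {ffun 'I_n -> 'I_p.+2}) : cube (grid_point v).
Proof.
move=> i; rewrite !mxE; have : 0 <= mesh p * (v i)%:R by rewrite mulr_ge0 // ltW ?mesh_gt0.
have : mesh p * (v i)%:R <= 2.
  by rewrite -(mesh_width p) ler_pM2l ?mesh_gt0 // ler_nat -ltnS.
by lra.
Qed.

Lemma approx_zero H (m : nat) :
  (forall i x, cube x -> x 0 i = -1 -> H i x <= 0) ->
  (forall i x, cube x -> x 0 i = 1 -> 0 <= H i x) ->
  exists2 y, cube y & forall i, exists z z', [/\ ball y (mesh m * 2) z,
    ball y (mesh m * 2) z', H i z <= 0 & 0 <= H i z'].
Proof.
move=> Hbot Htop; pose p := m.+1; pose pt := @grid_point m.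
have pt_cube := @grid_point_cube m.
(* The label is the sign of [H i], except that it is forced on the two facets as [kuhn] demands;
   there the boundary hypotheses supply the weak inequality that the label stands for. *)
pose g i (v : {ffun 'I_n -> 'I_p.+1}) : 'F_2 :=
  ((v i != ord0) && ((v i == ord_max) || (0 < H i (pt v))))%:R.
have [i v vi|i v vi|v [vp gv]] := @kuhn n p g.
- by rewrite /g vi eqxx.
- by rewrite /g vi eqxx.
exists (pt v) => [|i]; first exact: pt_cube.
 have [z [z' [zv zv' gz gz']]] := gv i.
(* Coordinates within a cell differ by at most [mesh m]; the factor 2 allows for balls being
   open. *)
have near_pt (w : {ffun 'I_n -> 'I_p.+1}) : (forall j, (v j <= w j <= (v j).+1)%N) ->
    ball (pt v) (mesh m * 2) (pt w).
  move=> wv; rewrite /ball /= /mx_ball; split; first by rewrite mulr_gt0 ?mesh_gt0.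
  move=> k j; rewrite /ball /= !mxE opprD addrACA subrr add0r -mulrBr.
  rewrite normrM gtr0_norm ?mesh_gt0 // ltr_pM2l ?mesh_gt0 //.
  by have /andP[] := wv j; rewrite -(ler_nat R) -(ler_nat R (w j)) -natr1 ltr_norml; lra.
exists (pt z), (pt z'); split; [exact: near_pt|exact: near_pt| |].
- move: gz; rewrite /g; case: eqVneq => [zi _|_ /=].
    by apply: Hbot => //; rewrite !mxE zi mulr0 addr0.
  by case: eqVneq => //= _; case: ltP.
- move: gz'; rewrite /g; case: eqVneq => [//|_ /=].
  case: eqVneq => [zi _|_] /=; last by case: ltP => // /ltW.
  by apply: Htop => //; rewrite !mxE zi /= mesh_width; lra.
Qed.

(** Approximate zeros on ever finer grids cluster at a point of the compact cube. Arbitrarily near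
    it each [H i] takes both weak signs, so continuity excludes a strict sign at the point. *)
Lemma poincare_miranda H : (forall i, continuous (H i)) ->
  (forall i x, cube x -> x 0 i = -1 -> H i x <= 0) ->
  (forall i x, cube x -> x 0 i = 1 -> 0 <= H i x) ->
  exists2 x, cube x & forall i, H i x = 0.
Proof.
move=> Hc Hbot Htop.
have /choice[y_ y_P] m : exists y, cube y /\ forall i, exists z z',
    [/\ ball y (mesh m * 2) z, ball y (mesh m * 2) z', H i z <= 0 & 0 <= H i z'].
  by have [y yc yP] := approx_zero m Hbot Htop; exists y.
have [|x [xc xy]] := @cube_compact (y_ @ \oo) _ _.
  by exists 0%N => // m _; have [] := y_P m.
have near_x (D : set 'rV[R]_n) : nbhs x D ->
    exists m, ball (y_ m) (mesh m * 2) `<=` D.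
  move=> /nbhs_ballP[e /= e0 eD].
  (* Makes the radius [mesh m * 2], which is [4 / m.+1], at most [e / 2]. *)
  pose m0 := Num.truncn (8 / e).
  have [||_ [[m m0m <-] xym]] := xy [set y_ m | m in [set m | (m0 <= m)%N]] (ball x (e / 2)).
  - by exists m0 => // m /= m0m; exists m.
  - by apply/nbhs_ballP; exists (e / 2) => //=; rewrite divr_gt0.
  exists m => z yz; apply: eD; apply: (ball_split xym).
  apply: le_ball yz.
  have m1 : 0 < m.+1%:R :> R by rewrite ltr0n.
  have : 8 / e <= m.+1%:R.
    by rewrite ltW // (lt_le_trans (truncnS_gt _)) // ler_nat ltnS.
  rewrite ler_pdivrMr // => me.
  by rewrite mulrAC ler_pdivrMr //; lra.
exists x => // i; apply: contrapT => /eqP; rewrite neq_lt => /orP[Hx|Hx].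
  have [|m mD] := near_x [set z | H i z < 0].
    exact: (Hc i x _ (lt_nbhsl Hx)).
  have [_ /(_ i)[z [z' [_ /mD/=]]]] := y_P m; by move=> /lt_le_trans h _ /h; rewrite ltxx.
have [|m mD] := near_x [set z | 0 < H i z].
  exact: (Hc i x _ (lt_nbhsr Hx)).
have [_ /(_ i)[z [z' [/mD/= Hz _]]]] := y_P m; by rewrite leNgt Hz.
Qed.

End PoincareMiranda.

(** * Continuity of pointwise operations, clamping, and zeros of outward-pointing maps *)

Section RealContinuity.
Context {R : realType} {T : topologicalType}.
Implicit Types f g : T -> R.

Lemma continuous_maxr f g : continuous f -> continuous g ->
  continuous (fun x => Num.max (f x) (g x)).
Proof.
move=> fc gc x; under eq_fun do rewrite maxr_absE.
by apply: cvgMl; apply: cvgD; [apply: cvgD; [exact: fc|exact: gc]|];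
  apply: cvg_norm; apply: cvgB; [exact: fc|exact: gc].
Qed.

Lemma continuous_minr f g : continuous f -> continuous g ->
  continuous (fun x => Num.min (f x) (g x)).
Proof.
move=> fc gc x; under eq_fun do rewrite minr_absE.
by apply: cvgMl; apply: cvgB; [apply: cvgD; [exact: fc|exact: gc]|];
  apply: cvg_norm; apply: cvgB; [exact: fc|exact: gc].
Qed.

Lemma continuous_cstr (k : R) : continuous (fun _ : T => k).
Proof. by move=> x; exact: cvg_cst. Qed.

Lemma continuous_addr f g : continuous f -> continuous g ->
  continuous (fun x => f x + g x).
Proof. by move=> fc gc x; apply: cvgD; [exact: fc|exact: gc]. Qed.

Lemma continuous_subr f g : continuous f -> continuous g ->
  continuous (fun x => f x - g x).
Proof. by move=> fc gc x; apply: cvgB; [exact: fc|exact: gc]. Qed.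

Lemma continuous_mulr f g : continuous f -> continuous g ->
  continuous (fun x => f x * g x).
Proof. by move=> fc gc x; apply: cvgM; [exact: fc|exact: gc]. Qed.

Lemma continuous_invr f : (forall x, f x != 0) -> continuous f ->
  continuous (fun x => (f x)^-1).
Proof. by move=> f0 fc x; apply: cvgV; [exact: f0|exact: fc]. Qed.

Lemma continuous_normr f : continuous f -> continuous (fun x => `|f x|).
Proof. by move=> fc x; apply: cvg_norm; exact: fc. Qed.

Lemma continuous_sumr (I : finType) (P : pred I) (F : I -> T -> R) :
  (forall i, P i -> continuous (F i)) -> continuous (fun x => \sum_(i | P i) F i x).
Proof. by move=> Fc; apply: continuous_big => // x; exact: add_continuous. Qed.

Lemma continuous_prodr (I : finType) (P : pred I) (F : I -> T -> R) :
  (forall i, P i -> continuous (F i)) -> continuous (fun x => \prod_(i | P i) F i x).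
Proof. by move=> Fc; apply: continuous_big => // x; exact: mul_continuous. Qed.

End RealContinuity.

Section Clamp.
Context {R : realType}.
Implicit Types a b t : R.

Definition clamp a b t : R := Num.max a (Num.min b t).

Lemma continuous_clamp (T : topologicalType) a b (f : T -> R) :
  continuous f -> continuous (fun x => clamp a b (f x)).
Proof.
move=> fc; apply: continuous_maxr; first exact: continuous_cstr.
by apply: continuous_minr => //; exact: continuous_cstr.
Qed.

Lemma clamp_itv a b t : a <= b -> a <= clamp a b t <= b.
Proof. by move=> ab; rewrite /clamp le_max lexx ge_max ab ge_min lexx. Qed.

Lemma clamp_id a b t : a <= t <= b -> clamp a b t = t.
Proof. by case/andP => at_ tb; rewrite /clamp (min_idPr tb) (max_idPr at_). Qed.

Lemma clamp_le a b t : t <= a -> a <= b -> clamp a b t = a.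
Proof. by move=> ta ab; rewrite /clamp (min_idPr (le_trans ta ab)) (max_idPl ta). Qed.

Lemma clamp_ge a b t : b <= t -> a <= b -> clamp a b t = b.
Proof. by move=> bt ab; rewrite /clamp (min_idPl bt) (max_idPr ab). Qed.

End Clamp.

(* Apply Poincare-Miranda to x - clamp (x - H x): at a zero x, each x_i H_i x
   is <= 0, with equality only if H_i x = 0. *)
Lemma zero_of_outward {R : realType} {n : nat} (H : 'I_n -> 'rV[R]_n -> R) :
  (forall i, continuous (H i)) ->
  (forall x, cube x -> (exists i, `|x 0 i| = 1) -> 0 <= \sum_i x 0 i * H i x) ->
  exists2 x, cube x & forall i, H i x = 0.
Proof.
move=> Hc Hout; pose G i (x : 'rV[R]_n) := x 0 i - clamp (-1) 1 (x 0 i - H i x).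
have N11 : -1 <= 1 :> R by lra.
have coordc i : continuous (fun x : 'rV[R]_n => x 0 i) by exact: coord_continuous.
have [i|i x xc xi|i x xc xi|x xc xG] := @poincare_miranda R n G.
- apply: continuous_subr; first exact: coordc.
  by apply: continuous_clamp; apply: continuous_subr; [exact: coordc|exact: Hc].
- by rewrite /G xi; have /andP[h _] := clamp_itv (-1 - H i x) N11; lra.
- by rewrite /G xi; have /andP[_ h] := clamp_itv (1 - H i x) N11; lra.
have P i : H i x = 0 \/ (`|x 0 i| = 1 /\ x 0 i * H i x < 0).
  have := xG i; rewrite /G => /eqP; rewrite subr_eq0 => /eqP xE.
  have /andP[x1 x2] := xc i.
  case: (ltgtP (H i x) 0) => Hi; [right|right|by left].
    have [h|h] := leP 1 (x 0 i - H i x).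
      rewrite clamp_ge // in xE.
      by rewrite xE normr1 mul1r.
    rewrite clamp_id in xE; lra.
  have [h|h] := leP (x 0 i - H i x) (-1).
    rewrite clamp_le // in xE.
    by rewrite xE normrN normr1 mulN1r oppr_lt0.
  rewrite clamp_id in xE; lra.
exists x => // i; case: (P i) => // -[xi xHi].
have := Hout x xc (ex_intro _ i xi); rewrite (bigD1 i) //=.
suff : \sum_(j < n | j != i) x 0 j * H j x <= 0 by lra.
by apply: sumr_le0 => j _; case: (P j) => [->|[_ /ltW//]]; rewrite mulr0.
Qed.

(** * Points moving on a star of paths *)

(* Weights w_0, ..., w_{m-1} of sum 1 cut [0, N] into consecutive segments
   [cumul i, cumul i.+1] of length N w_i. The j-th of the N points sits at the
   end of the path g_i if [j, j+1] lies in the i-th segment, at the common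
   origin of the paths if its midpoint j + 1/2 is a breakpoint, and in between
   on g_i if the midpoint is closer than 1/2 to a breakpoint. *)
Section StarInterpolation.
Context {R : realType}.
Variables (m N : nat).
Implicit Types (w : 'I_m -> R) (i : 'I_m) (j : 'I_N).

Definition cumul w (k : nat) : R := N%:R * \sum_(i < m | (i < k)%N) w i.

(** The distance from the midpoint to the nearer end of the segment, negative outside it, doubled so
    that 1/2 becomes 1, then clamped. *)
Definition reach w j i : R :=
  clamp 0 1 (2 * Num.min (j%:R + 2^-1 - cumul w i) (cumul w i.+1 - (j%:R + 2^-1))).

Lemma continuous_reach (T : topologicalType) (w : T -> 'I_m -> R) j i :
  (forall k, continuous (w^~ k)) -> continuous (fun x => reach (w x) j i).
Proof.
move=> wc; have cc k : continuous (fun x => cumul (w x) k).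
  by apply: continuous_mulr; [exact: continuous_cstr|exact: continuous_sumr].
apply: continuous_clamp; apply: continuous_mulr; first exact: continuous_cstr.
by apply: continuous_minr; apply: continuous_subr => //; exact: continuous_cstr.
Qed.

Section Weights.
Variable w : 'I_m -> R.
Hypothesis w_ge0 : forall i, 0 <= w i.

Lemma cumul_homo (k l : nat) : (k <= l)%N -> cumul w k <= cumul w l.
Proof.
move=> kl; rewrite ler_wpM2l // [leRHS](bigID (fun i : 'I_m => (i < k)%N)) /=.
rewrite [X in _ <= X + _](eq_bigl (fun i : 'I_m => (i < k)%N)) ?lerDl ?sumr_ge0 // => i.
by case: (ltnP i k) => [/leq_trans->|]; rewrite ?andbF.
Qed.

Lemma cumulS i : cumul w i.+1 = cumul w i + N%:R * w i.
Proof.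
rewrite /cumul -mulrDr (bigD1 i) //= addrC; congr (_ * (_ + _)); apply: eq_bigl => k.
by rewrite ltnS -(inj_eq val_inj) /=; case: ltngtP.
Qed.

Lemma cumul0 : cumul w 0 = 0.
Proof. by rewrite /cumul big1 ?mulr0. Qed.

Lemma reach_neq0 j i : reach w j i != 0 -> cumul w i < j%:R + 2^-1 < cumul w i.+1.
Proof.
apply: contra_neqT; rewrite negb_and -!leNgt => h; apply: clamp_le => //.
by rewrite pmulr_rle0 // ge_min !subr_le0.
Qed.

(** Distinct segments have disjoint interiors, so the midpoint is interior to at most one. *)
Lemma reach_uniq j i i' : reach w j i != 0 -> reach w j i' != 0 -> i = i'.
Proof.
wlog ii' : i i' / (i <= i')%N.
  by move=> h ri ri'; case/orP: (leq_total i i') => /h; [|move=> h'; symmetry]; auto.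
move=> /reach_neq0/andP[_ h1] /reach_neq0/andP[h2 _]; apply: val_inj; apply/eqP.
rewrite eqn_leq ii' leqNgt /=; apply/negP => /cumul_homo; lra.
Qed.

Lemma reach1 j i : cumul w i <= j%:R -> j.+1%:R <= cumul w i.+1 -> reach w j i = 1.
Proof.
move=> h1; rewrite -natr1 => h2; apply: clamp_ge => //.
by rewrite -(@ler_pM2l _ 2^-1) ?invr_gt0 // mulKf ?pnatr_eq0 // le_min; lra.
Qed.

Hypothesis w_sum1 : \sum_i w i = 1.
Hypothesis N_gt0 : (0 < N)%N.

Lemma cumulm : cumul w m = N%:R.
Proof. by rewrite /cumul (eq_bigl xpredT) ?w_sum1 ?mulr1 // => i; rewrite ltn_ord. Qed.

Lemma crossing (t : R) : 0 <= t < N%:R ->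
  exists2 i : 'I_m, 0 < w i & cumul w i <= t < cumul w i.+1.
Proof.
case/andP=> t0 tN; have ex : exists k, t < cumul w k by exists m; rewrite cumulm.
case: (ex_minnP ex) => -[|k]; rewrite ?cumul0 => tk kmin; first by lra.
have km : (k < m)%N by apply: kmin; rewrite cumulm.
have ck : cumul w k <= t by rewrite leNgt; apply/negP => /kmin; rewrite ltnn.
exists (Ordinal km); last by rewrite ck.
have := le_lt_trans ck tk; rewrite -[k]/(nat_of_ord (Ordinal km)) cumulS ltrDl.
by rewrite pmulr_rgt0 ?ltr0n.
Qed.

(** If the point [j] is in transit, the segment with [cumul w i <= j < cumul w i.+1] ends before
    [j + 1]. Sending [j] to this [i] is injective into the indices of positive weight, and misses
    the last of them, whose segment ends at [N]; hence the strict inequality. *)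
Lemma card_in_transit :
  (#|[pred j : 'I_N | ~~ [exists i : 'I_m,
        (cumul w i <= j%:R)%R && (j.+1%:R <= cumul w i.+1)%R]]|
   < #|[pred i : 'I_m | (0 < w i)%R]|)%N.
Proof.
set B := [pred j : 'I_N | _]; set S := [pred i : 'I_m | _].
have /choice[f fP] j : exists i : 'I_m, 0 < w i /\ cumul w i <= j%:R < cumul w i.+1.
  have [|i wi ci] := @crossing j%:R; last by exists i.
  by rewrite ler0n ltr_nat ltn_ord.
have fB j : j \in B -> j%:R < cumul w (f j).+1 < j.+1%:R.
  move=> jB; have [_ /andP[h1 ->]] := fP j; rewrite ltNge; apply/negP => h2.
  by move: jB; rewrite inE => /existsP; apply; exists (f j); rewrite h1.
have finj : {in B &, injective f}.
  move=> j j' /fB/andP[h1 h2] /fB/andP[h1' h2'] ff'; rewrite ff' in h1 h2.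
  apply: val_inj; apply/eqP; rewrite eqn_leq -!(ltnS (_ : 'I_N)) -!(ltr_nat R).
  by rewrite (lt_trans h1 h2') (lt_trans h1' h2).
have [i0 i0S ci0] : exists2 i : 'I_m, i \in S & cumul w i.+1 = N%:R.
  have ex : exists k, N%:R <= cumul w k by exists m; rewrite cumulm.
  case: (ex_minnP ex) => -[|k]; rewrite ?cumul0 => Nk kmin.
    by move: Nk; rewrite lern0 -leqn0 leqNgt N_gt0.
  have km : (k < m)%N by apply: kmin; rewrite cumulm.
  have ck : cumul w k < N%:R by rewrite ltNge; apply/negP => /kmin; rewrite ltnn.
  exists (Ordinal km).
    rewrite inE; have := lt_le_trans ck Nk; rewrite -[k]/(nat_of_ord (Ordinal km)) cumulS ltrDl.
    by rewrite pmulr_rgt0 ?ltr0n.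
  by apply/eqP; rewrite eq_le Nk -cumulm cumul_homo.
rewrite -(card_in_imset finj); apply: proper_card; apply/properP; split.
  by apply/fintype.subsetP => _ /imsetP[j _ ->]; rewrite inE; case: (fP j).
exists i0 => //; apply/negP => /imsetP[j /fB/andP[_ h] i0E].
by move: h; rewrite -i0E ci0 ltr_nat ltnS leqNgt ltn_ord.
Qed.

End Weights.

Variables (X : Type) (x0 : X) (gam : 'I_m -> R -> X).

Definition star_point w j : X :=
  if [pick i | reach w j i != 0] is Some i then gam i (reach w j i) else x0.

(** At most one summand is nonzero. This form involves no choice of [i], which makes continuity in
    the weights visible. *)
Lemma star_point_sum w j (f : X -> R) :
  (forall i, 0 <= w i) -> (forall i, gam i 0 = x0) ->
  f (star_point w j) = f x0 + \sum_i (f (gam i (reach w j i)) - f x0).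
Proof.
move=> w0 gam0; rewrite /star_point; case: pickP => [i ri|r0].
  rewrite (bigD1 i) //= big1 ?addr0 => [|i' ii']; first by rewrite addrC subrK.
  case: (eqVneq (reach w j i') 0) => [->|ri']; first by rewrite gam0 subrr.
  by rewrite (reach_uniq w0 ri ri') eqxx in ii'.
rewrite big1 ?addr0 // => i _; by have /negbFE/eqP-> := r0 i; rewrite gam0 subrr.
Qed.

Lemma star_point_end w j i : (forall k, 0 <= w k) -> reach w j i = 1 ->
  star_point w j = gam i 1.
Proof.
move=> w0 ri; have rn0 : reach w j i != 0 by rewrite ri oner_neq0.
rewrite /star_point; case: pickP => [i' /(reach_uniq w0 rn0) <-|/(_ i)];
  [by rewrite ri|by rewrite rn0].
Qed.

End StarInterpolation.

(** * Weights on the grid *)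

(* The hat functions of the Freudenthal triangulation of the cube, up to
   normalization. *)
Section Hat.
Context {R : realType}.
Variables (n p : nat).
Local Notation grid := {ffun 'I_n -> 'I_p.+2}.
Local Notation h := (@mesh R p).
Implicit Types (v : grid) (c : 'rV[R]_n).

(** The piecewise linear hat is the minimum of these factors over [i] and [j]; the product is
    continuous and positive at the same points, which suffices. *)
Definition hat v c : R := \prod_i \prod_j Num.max 0
  (h - Num.max 0 (c 0 i - grid_point v 0 i) - Num.max 0 (grid_point v 0 j - c 0 j)).

Lemma hat_ge0 v c : 0 <= hat v c.
Proof. by apply: prodr_ge0 => i _; apply: prodr_ge0 => j _; rewrite le_max lexx. Qed.

Lemma continuous_hat v : continuous (hat v).
Proof.
have coord_c i : continuous (fun c : 'rV[R]_n => c 0 i) by exact: coord_continuous.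
apply: continuous_prodr => i _; apply: continuous_prodr => j _.
by do ![apply: continuous_maxr| apply: continuous_subr| exact: continuous_cstr | exact: coord_c].
Qed.

Lemma hat_gt0 v c : 0 < hat v c <-> forall i j,
  Num.max 0 (c 0 i - grid_point v 0 i) + Num.max 0 (grid_point v 0 j - c 0 j) < h.
Proof.
split => [h0 i j|vc].
  rewrite ltNge; apply/negP => hij; move: h0.
  rewrite /hat (bigD1 i) //= (bigD1 j) //= (max_idPl _); first by rewrite !mul0r ltxx.
  lra.
by apply: prodr_gt0 => i _; apply: prodr_gt0 => j _; rewrite lt_max; have := vc i j; lra.
Qed.

Lemma hat_gt0_dist v c i : 0 < hat v c -> `|c 0 i - grid_point v 0 i| < h.
Proof.
move/hat_gt0/(_ i i).
have [] := (lerP 0 (c 0 i - grid_point v 0 i), lerP 0 (grid_point v 0 i - c 0 i)).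
by case=> ?; case=> ?; rewrite ltr_norml; lra.
Qed.

(** Rounding every coordinate of [c] down to the grid leaves excesses below the mesh and no
    deficits. *)
Lemma exists_hat_gt0 c : cube c -> exists v, 0 < hat v c.
Proof.
move=> cc; have h0 := @mesh_gt0 R p.
have /choice[v vP] (i : 'I_n) : exists k : 'I_p.+2, h * k%:R <= c 0 i + 1 < h * k%:R + h.
  have /andP[c1 c2] := cc i.
  have u0 : 0 <= (c 0 i + 1) / h by rewrite divr_ge0 ?(ltW h0) //; lra.
  have /andP[t1 t2] := truncn_itv u0.
  set t := (c 0 i + 1) / h in u0 t1 t2; have kp : (Num.truncn t < p.+2)%N.
    rewrite ltnS -(ler_nat R) (le_trans t1) // /t ler_pdivrMr // mulrC mesh_width; lra.
  exists (Ordinal kp) => /=; move: t1 t2; rewrite {2 3}/t.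
  by rewrite ler_pdivlMr // ltr_pdivrMr // -natr1 mulrDl mul1r mulrC => -> ->.
exists [ffun i => v i]; apply: (hat_gt0 _ _).2 => i j; rewrite !mxE !ffunE.
have /andP[i1 i2] := vP i; have /andP[j1 j2] := vP j.
by rewrite [X in _ + X]max_l ?addr0 ?gt_max; [apply/andP; split|]; lra.
Qed.

(** Otherwise the gaps from [v i] up to [v' i] and from [v' j] up to [v j] total at least two mesh
    widths, whereas the hat conditions at [(i, j)] and [(j, i)] bound the total strictly by two. So
    the vertices active at [c] form a chain. *)
Lemma hat_no_crossing v v' c i j : 0 < hat v c -> 0 < hat v' c ->
  (v i < v' i)%N -> (v j <= v' j)%N.
Proof.
move=> /hat_gt0/(_ i j) vc /hat_gt0/(_ j i) v'c ii'; rewrite leqNgt; apply/negP => jj'.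
have h0 := @mesh_gt0 R p.
have hi : h + h * (v i)%:R <= h * (v' i)%:R.
  by rewrite -[X in X + _]mulr1 -mulrDr ler_pM2l // addrC natr1 ler_nat.
have hj : h + h * (v' j)%:R <= h * (v j)%:R.
  by rewrite -[X in X + _]mulr1 -mulrDr ler_pM2l // addrC natr1 ler_nat.
have max_ge (x : R) : x <= Num.max 0 x by rewrite le_max lexx orbT.
have := max_ge (c 0 i - grid_point v 0 i); have := max_ge (grid_point v 0 j - c 0 j).
have := max_ge (c 0 j - grid_point v' 0 j); have := max_ge (grid_point v' 0 i - c 0 i).
by rewrite !mxE in vc v'c *; lra.
Qed.

Lemma hat_close v v' c i : 0 < hat v c -> 0 < hat v' c -> (v i <= (v' i).+1)%N.
Proof.
move=> /(hat_gt0_dist i) + /(hat_gt0_dist i); rewrite !mxE !ltr_norml.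
move=> /andP[v1 v2] /andP[v1' v2']; rewrite leqNgt; apply/negP => vv'.
have h0 := @mesh_gt0 R p.
have : h + h + h * (v' i)%:R <= h * (v i)%:R.
  have -> : h + h = h * 2 by lra.
  by rewrite -mulrDr ler_pM2l // -natrD addnC ler_nat addn2.
by lra.
Qed.

(** The coordinate [c 0 k] is itself a node, and an active vertex differs from it by less than the
    mesh. *)
Lemma hat_face v v' c k : `|c 0 k| = 1 -> 0 < hat v c -> 0 < hat v' c -> v k = v' k.
Proof.
have h0 := @mesh_gt0 R p; have hp := @mesh_width R p.
suff H (w : grid) : `|c 0 k| = 1 -> 0 < hat w c ->
    w k = (if 0 <= c 0 k then p.+1 else 0) :> nat.
  by move=> ck /(H _ ck) vE /(H _ ck) v'E; apply: val_inj; rewrite /= vE v'E.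
move=> ck /(hat_gt0_dist k); rewrite mxE ltr_norml => /andP[w1 w2].
apply/eqP; move: ck; case: ifPn => [c0|]; last rewrite -ltNge => c0.
  rewrite ger0_norm // => ck; rewrite eqn_leq -ltnS ltn_ord /= -ltnS -(ltr_nat R).
  by rewrite -(ltr_pM2l h0) hp -[(w k).+1]addn1 natrD mulrDr; lra.
rewrite ltr0_norm // => ck; rewrite -leqn0 -ltnS -(ltr_nat R) -(ltr_pM2l h0); lra.
Qed.

(** In a chain the coordinate sums are distinct. From the lowest active vertex, coordinate [k]
    cannot move and the other [n - 1] grow by at most 1 each, which leaves [n] values for the
    sum. *)
Lemma card_hat_gt0 c k : `|c 0 k| = 1 -> (#|[pred v | (0 < hat v c)%R]| <= n)%N.
Proof.
move=> ck; set S := [pred v | _].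
have [-> //|] := eqVneq #|S| 0%N; rewrite -lt0n => /card_gt0P[v1 v1S].
pose s v := (\sum_i v i)%N.
have mono v v' : v \in S -> v' \in S -> (s v <= s v')%N -> forall i, (v i <= v' i)%N.
  move=> vS v'S ss i; rewrite leqNgt; apply/negP => ii'; move: ss; rewrite leqNgt => /negP; apply.
  rewrite /s (bigD1 i) //= [ltnRHS](bigD1 i) //= -addSn leq_add // leq_sum // => j _.
  exact: hat_no_crossing v'S vS ii'.
have [v0 v0S v0min] := arg_minnP s v1S.
apply: leq_trans (_ : size (iota (s v0) n) <= n)%N; last by rewrite size_iota.
rewrite cardE -(size_map s); apply: uniq_leq_size.
  rewrite map_inj_in_uniq ?enum_uniq // => v v'; rewrite !mem_enum => vS v'S ss.
  apply/ffunP => i; apply: val_inj; apply/eqP; rewrite /= eqn_leq.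
  by rewrite !mono // ss.
move=> _ /mapP[v + ->]; rewrite mem_enum mem_iota => vS; rewrite v0min //=.
rewrite /s (bigD1 k) //= [X in (_ < X + _)%N](bigD1 k) //= (hat_face ck vS v0S).
rewrite -addnA ltn_add2l.
have nE : n = (1 + \sum_(i < n | i != k) 1)%N.
  by rewrite sum1_card cardC1 card_ord add1n prednK // (leq_ltn_trans _ (ltn_ord k)).
rewrite [X in (_ + X)%N]nE addnCA add1n ltnS -big_split /=; apply: leq_sum => i _.
by rewrite addn1; exact: hat_close vS v0S.
Qed.

End Hat.

(** * Balanced points *)

(** Clamping the parameter extends a path on [[0, 1]] to a map continuous on the whole line. *)
Lemma path_connected_continuous {R : realType} {X : topologicalType} (x y : X) :
  path_connected R X -> exists gam : R -> X, [/\ continuous gam, gam 0 = x & gam 1 = y].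
Proof.
move=> /(_ x y)[g [/subspace_continuousP gc g0 g1]].
exists (fun t => g (clamp 0 1 t)); split; last 2 first.
- by rewrite clamp_id // lexx ler01.
- by rewrite clamp_id // lexx ler01.
have cc : continuous (fun t : R => clamp 0 1 t).
  by apply: (@continuous_clamp R R 0 1 id) => s.
have ct01 s : `[0, 1]%classic (clamp 0 1 s : R) by rewrite /= in_itv /= clamp_itv.
move=> t A nA.
have H : nbhs t [set s | `[0, 1]%classic (clamp 0 1 s : R) -> A (g (clamp 0 1 s))].
  exact: (cc t _ (gc _ (ct01 t) A nA)).
have : nbhs t [set s | A (g (clamp 0 1 s))] by apply: filterS H => s; apply; exact: ct01.
by [].
Qed.

(** * The supremum of a linear combination as a function of its coefficients *)

Section SpanSup.
Context {R : realType} {X : pointedType} {M : nat}.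
Variables (b : 'I_M -> X -> R) (B : R).
Hypothesis b_bounded : forall k x, `|b k x| <= B.
Implicit Types c : 'rV[R]_M.

Definition comb c (x : X) : R := \sum_k c 0 k * b k x.
Definition comb_sup c : R := sup (range (comb c)).

Let B_ge0 (k : 'I_M) : 0 <= B. Proof. exact: le_trans (normr_ge0 _) (b_bounded k point). Qed.

Lemma comb_close c c' d x : (forall k, `|c 0 k - c' 0 k| <= d) ->
  comb c x <= comb c' x + M%:R * (B * d).
Proof.
move=> cc'; rewrite -lerBlDl -sumrB (_ : _ * _ = \sum_(k < M) B * d); last first.
  by rewrite mulr_natl sumr_const card_ord.
apply: ler_sum => k _; rewrite -mulrBl (le_trans (ler_norm _)) // normrM mulrC.
by rewrite ler_pM.
Qed.

Lemma has_sup_comb c : has_sup (range (comb c)).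
Proof.
split; first by exists (comb c point); exists point.
exists (\sum_k `|c 0 k| * B) => _ [x _ <-]; apply: ler_sum => k _.
by rewrite (le_trans (ler_norm _)) // normrM ler_wpM2l.
Qed.

Lemma comb_sup_ge c x : comb c x <= comb_sup c.
Proof. by apply: ub_le_sup; [case: (has_sup_comb c)|exists x]. Qed.

Lemma comb_sup_close c c' d : (forall k, `|c 0 k - c' 0 k| <= d) ->
  comb_sup c <= comb_sup c' + M%:R * (B * d).
Proof.
move=> cc'; apply: ge_sup; first by exists (comb c point); exists point.
by move=> _ [x _ <-]; rewrite (le_trans (comb_close _ cc')) // lerD2r comb_sup_ge.
Qed.

Lemma continuous_comb_sup : continuous comb_sup.
Proof.
move=> c A /nbhs_ballP[e /= e0 eA]; apply/nbhs_ballP.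
(* The summand 1 makes [L] positive and keeps the final bound [e - e / L] below [e]. *)
set L := M%:R * B + 1; have L0 : 0 < L.
  rewrite ltr_pwDr // (_ : _ * _ = \sum_(k < M) B); last by rewrite mulr_natl sumr_const card_ord.
  by apply: sumr_ge0 => k _; exact: B_ge0.
exists (e / L); first by rewrite /= divr_gt0.
move=> c' [_ cc']; apply: eA.
have cd k : `|c 0 k - c' 0 k| <= e / L by apply: ltW; have := cc' 0 k.
have cd' k : `|c' 0 k - c 0 k| <= e / L by rewrite distrC.
have := comb_sup_close cd; have := comb_sup_close cd'.
have -> : M%:R * (B * (e / L)) = e - e / L.
  have eL : e / L * L = e by rewrite divfK // gt_eqF.
  by rewrite -[X in _ = X - _]eL; set q := e / L; rewrite /L; ring.
have : 0 < e / L by rewrite divr_gt0.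
by rewrite /ball /= ltr_norml; lra.
Qed.

Lemma comb_sup_lower_bound : (forall c, c != 0 -> 0 < comb_sup c) ->
  exists2 s : R, 0 < s & forall c, cube c -> (exists k, `|c 0 k| = 1) -> s <= comb_sup c.
Proof.
(* [D] is compact, contains the boundary of the cube and avoids 0, so the minimum of [comb_sup] on
   it is positive. *)
move=> S0; pose D := cube `&` [set c : 'rV[R]_M | 1 <= \sum_k `|c 0 k|].
have Dc : compact D.
  apply: compact_closedI; first exact: cube_compact.
  rewrite (_ : [set c | _] = (fun c : 'rV[R]_M => \sum_k `|c 0 k|) @^-1` [set x | 1 <= x])//.
  apply: closed_comp; last exact: closed_ge.
  move=> c _; apply: continuous_sumr => k _; apply: continuous_normr; exact: coord_continuous.
have bdD c : cube c -> (exists k, `|c 0 k| = 1) -> D c.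
  move=> cc [k ck]; split => //=; rewrite (bigD1 k) //= ck lerDl.
  by apply: sumr_ge0.
have [D0|/set0P Dn0] := eqVneq D set0.
  exists 1 => // c cc /(bdD _ cc); by rewrite D0.
have [|c0 /set_mem c0D c0min] := EVT_min_rV Dn0 Dc (f := comb_sup).
  exact: continuous_subspaceT continuous_comb_sup.
exists (comb_sup c0).
  apply: S0; apply: contraTneq c0D.2 => ->.
  by rewrite /= big1 ?ler10 // => k _; rewrite mxE normr0.
by move=> c cc /(bdD _ cc) cD; apply: c0min; exact: mem_set.
Qed.

End SpanSup.

(** * The outward-pointing map and its zero *)

Section BalancedPoints.
Context {R : realType} {X : ptopologicalType} {M : nat}.
Variables (b : 'I_M -> X -> R) (B K : R) (N : nat).
Hypothesis X_path_connected : path_connected R X.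
Hypothesis b_continuous : forall k, continuous (b k).
Hypothesis b_bounded : forall k x, `|b k x| <= B.
Hypothesis sup_gt0 : forall c, c != 0 -> 0 < comb_sup b c.
Hypothesis inf_ge : forall c x, c != 0 -> - comb b c x <= K * comb_sup b c.
Hypothesis K_ge0 : 0 <= K.
Hypothesis M_gt0 : (0 < M)%N.
Hypothesis N_large : (M%:R - 1) * (K + 1) < N%:R.

Let N_gt0 : (0 < N)%N.
Proof.
by rewrite -(ltr_nat R) (le_lt_trans _ N_large) // mulr_ge0 ?subr_ge0 ?ler1n ?addr_ge0.
Qed.

Lemma balanced_points : exists p : 'I_N -> X, forall k, \sum_j b k (p j) = 0.
Proof.
have [s s0 sP] := comb_sup_lower_bound b_bounded sup_gt0.
set theta := N%:R - (M%:R - 1) * (K + 1).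
have theta0 : 0 < theta by rewrite subr_gt0.
have N0 : 0 < N%:R :> R by rewrite ltr0n.
(* The loss allowed per point: in total [s * theta], the slack that [N_large] guarantees when the
   supremum is at least [s]. *)
set eta := s * theta / N%:R; have eta0 : 0 < eta by rewrite divr_gt0 // mulr_gt0.
have B0 : 0 <= B by exact: le_trans (normr_ge0 _) (b_bounded (Ordinal M_gt0) point).
(* At an end point there are three losses of at most [eta / 4]: replacing [c] by a vertex in the
   supremum, the gap in [yP], and returning from the vertex to [c]. *)
have [p pP] : exists p, M%:R * (B * @mesh R p) <= eta / 4.
  exists (Num.truncn (M%:R * B * 8 / eta)); rewrite /mesh.
  set q := Num.truncn _; have := truncnS_gt (M%:R * B * 8 / eta); rewrite -/q.
  rewrite ltr_pdivrMr // => h; have q0 : 0 < q.+1%:R :> R by rewrite ltr0n.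
  by rewrite !mulrA ler_pdivrMr //; lra.
pose grid := {ffun 'I_M -> 'I_p.+2}.
have /choice[y yP] (v : grid) : exists x,
    comb_sup b (grid_point v) - eta / 4 < comb b (grid_point v) x.
  have e4 : 0 < eta / 4 by rewrite divr_gt0.
  by have [_ [x _ <-] h] := sup_adherent e4 (has_sup_comb b_bounded (grid_point v)); exists x.
pose m := #|{: grid}|; pose vert (i : 'I_m) : grid := enum_val i.
have /choice[gam gamP] (i : 'I_m) : exists g : R -> X,
    [/\ continuous g, g 0 = point & g 1 = y (vert i)].
  exact: path_connected_continuous.
(* The second sum vanishes on the cube and keeps total positive outside it. *)
pose total (c : 'rV[R]_M) := \sum_(i < m) hat (vert i) c + \sum_k Num.max 0 (`|c 0 k| - 1).
have vert_inj : injective vert by exact: enum_val_inj.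
have sum_hat (c : 'rV[R]_M) : \sum_(i < m) hat (vert i) c = \sum_(v : grid) hat v c.
  by rewrite [RHS](reindex vert) //; apply: onW_bij; exact: enum_val_bij.
have sum_hat_ge0 (c : 'rV[R]_M) : 0 <= \sum_(i < m) hat (vert i) c.
  by apply: sumr_ge0 => i _; exact: hat_ge0.
have sum_max_ge0 (c : 'rV[R]_M) (P : pred 'I_M) :
    0 <= \sum_(k | P k) Num.max 0 (`|c 0 k| - 1).
  by apply: sumr_ge0 => k _; rewrite le_max lexx.
have total_gt0 c : 0 < total c.
  have [cc|/existsNP[k ck]] := pselect (cube c).
    have [v vc] := exists_hat_gt0 p cc; apply: ltr_wpDr => //.
    rewrite sum_hat (bigD1 v) //= ltr_pwDl // sumr_ge0 // => u _; exact: hat_ge0.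
  apply: ltr_wpDl => //; rewrite (bigD1 k) //= ltr_pwDl // lt_max.
  by apply/orP; right; rewrite subr_gt0 ltNge ler_norml; apply/negP.
have total_cube c : cube c -> total c = \sum_(i < m) hat (vert i) c.
  move=> cc; rewrite /total [X in _ + X]big1 ?addr0 // => k _.
  by apply/max_idPl; rewrite subr_le0 ler_norml.
pose w (c : 'rV[R]_M) (i : 'I_m) := hat (vert i) c / total c.
have w_ge0 c i : 0 <= w c i by rewrite divr_ge0 ?hat_ge0 // ltW.
have w_gt0 c i : (0 < w c i) = (0 < hat (vert i) c).
  by rewrite /w pmulr_lgt0 // invr_gt0.
have w_sum1 c : cube c -> \sum_i w c i = 1.
  by move=> cc; rewrite -mulr_suml -total_cube // divff // gt_eqF.
have w_cont i : continuous (w^~ i).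
  apply: continuous_mulr; first exact: continuous_hat.
  apply: continuous_invr => [c|]; first by rewrite gt_eqF.
  apply: continuous_addr; apply: continuous_sumr => k _; first exact: continuous_hat.
  apply: continuous_maxr; first exact: continuous_cstr.
  apply: continuous_subr; last exact: continuous_cstr.
  by apply: continuous_normr; exact: coord_continuous.
pose pt c (j : 'I_N) := star_point point gam (w c) j.
pose H k c := \sum_(j < N) b k (pt c j).
have gam0 i : gam i 0 = point by case: (gamP i).
have H_cont k : continuous (H k).
  apply: continuous_sumr => j _.
  under eq_fun do rewrite /pt (star_point_sum _ _ (w_ge0 _) gam0).
  apply: continuous_addr; first exact: continuous_cstr.
  apply: continuous_sumr => i _; apply: continuous_subr; last exact: continuous_cstr.
  move=> c.
  apply: (@continuous_comp _ _ _ (fun c => reach (w c) j i) (fun t => b k (gam i t))).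
    exact: continuous_reach.
  apply: (@continuous_comp _ _ _ (gam i) (b k)); last exact: b_continuous.
  by case: (gamP i) => + _ _; apply.
have [c cc ck|c cc Hc0] := zero_of_outward H_cont; last by exists (pt c).
have [k ck1] := ck.
have -> : \sum_i c 0 i * H i c = \sum_j comb b c (pt c j).
  by rewrite exchange_big /=; apply: eq_bigr => i _; rewrite mulr_sumr.
set S := comb_sup b c.
have c_neq0 : c != 0.
  by apply: contra_eq_neq ck1 => ->; rewrite mxE normr0 eq_sym oner_neq0.
have sS : s <= S by exact: sP.
pose good (j : 'I_N) := [exists i : 'I_m,
  (cumul N (w c) i <= j%:R) && (j.+1%:R <= cumul N (w c) i.+1)].
have good_ge j : good j -> S - eta <= comb b c (pt c j).
  case/existsP=> i /andP[i1 i2]; rewrite /pt (star_point_end _ _ (w_ge0 c) (reach1 i1 i2)).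
  have [_ _ ->] := gamP i.
  (* The segment contains [[j, j + 1]], so its length [N * w c i] is at least 1. *)
  have wi : 0 < w c i.
    rewrite cumulS -natr1 in i2; rewrite -(pmulr_rgt0 _ N0).
    by move: i1 i2; set x := N%:R * _; lra.
  rewrite w_gt0 in wi.
  have cl l : `|c 0 l - grid_point (vert i) 0 l| <= @mesh R p.
    by rewrite ltW // hat_gt0_dist.
  have cl' l : `|grid_point (vert i) 0 l - c 0 l| <= @mesh R p by rewrite distrC.
  have := comb_sup_close b_bounded cl; have := comb_close b_bounded (y (vert i)) cl'.
  by have := yP (vert i); rewrite -/S; lra.
have bad_ge j : - (K * S) <= comb b c (pt c j).
  by rewrite lerNl; exact: inf_ge.
pose bad := [pred j : 'I_N | ~~ good j].
have card_bad : #|bad|%:R <= M%:R - 1 :> R.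
  rewrite lerBrDr natr1 ler_nat.
  apply: leq_trans (card_in_transit (w_ge0 c) (w_sum1 _ cc) N_gt0) _.
  apply: leq_trans (card_hat_gt0 p ck1); rewrite -(fintype.card_image vert_inj).
  apply: subset_leq_card; apply/fintype.subsetP => _ /fintype.imageP[i iw ->].
  by move: iw; rewrite !inE w_gt0.
(* Every point is charged [eta] against [S], and a bad one a further [S + K * S]. With [card_bad]
   the sum is at least [S * theta - s * theta]. *)
apply: (@le_trans _ _ (\sum_(j < N) (S - eta - (if good j then 0 else S + K * S)))).
  rewrite sumrB sumr_const card_ord -mulr_natl.
  have -> : \sum_(j < N) (if good j then 0 else S + K * S) = #|bad|%:R * (S + K * S).
    rewrite mulr_natl -sumr_const [RHS]big_mkcond /=; apply: eq_bigr => j _.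
    by rewrite !inE; case: ifP.
  have S0 : 0 <= S + K * S by rewrite addr_ge0 ?mulr_ge0 // (le_trans (ltW s0)).
  have := ler_wpM2r S0 card_bad.
  have : s * theta <= S * theta by rewrite ler_pM2r.
  have : N%:R * eta = s * theta by rewrite mulrC divfK // gt_eqF.
  by rewrite mulrBr /theta; lra.
apply: ler_sum => j _; case: ifPn => [/good_ge|_]; rewrite ?subr0 //.
by have := bad_ge j; lra.
Qed.

End BalancedPoints.

(** * Mean-zero functions and designs *)

Section BorelIntegration.
Context {R : realType} {X : ptopologicalType}.
Variable mu : probability (borelType X) R.

Lemma continuous_borel_measurable (f : X -> R) : continuous f ->
  measurable_fun [set: borelType X] (f : borelType X -> R).
Proof.
move=> /continuousP fo; apply: (measurability _ (RGenOpens.measurableE R)).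
move=> _ [_ [a [b ->]] <-]; rewrite setTI.
by apply: sub_sigma_algebra; apply: fo; exact: interval_open.
Qed.

Lemma continuous_bounded_integrable (f : X -> R) (B : R) : continuous f ->
  (forall x, `|f x| <= B) -> mu.-integrable [set: borelType X] (fun x => (f x)%:E).
Proof.
move=> fc fB; apply: (@measurable_bounded_integrable _ (borelType X) R mu f) => //.
- by rewrite (le_lt_trans (probability_le1 _ _)) // ltry.
- exact: continuous_borel_measurable.
- exists B; split; first exact: num_real.
  by move=> B' BB' x _; exact: le_trans (fB x) (ltW BB').
Qed.

(** A function negative everywhere with integral 0 would vanish almost everywhere, making the whole
    space a null set. *)
Lemma mean_zero_exists_ge0 (f : X -> R) : continuous f ->
  (\int[mu]_x (f x)%:E = 0)%E -> exists x, 0 <= f x.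
Proof.
move=> fc f0; apply: contrapT => fN.
have flt0 x : f x < 0 by rewrite ltNge; apply/negP => fx; apply: fN; exists x.
have mf : measurable_fun [set: borelType X] (EFin \o (f : borelType X -> R)).
  by apply/measurable_EFinP; exact: continuous_borel_measurable.
have : (\int[mu]_x `|(f x)%:E| = 0)%E.
  under eq_integral do rewrite /= ltr0_norm // EFinN.
  rewrite integralN ?f0 ?oppe0 //; apply: fin_num_adde_defr.
  rewrite integral0_eq // => x _.
  by rewrite funeposE; apply/max_idPr; rewrite lee_fin ltW.
move=> /(ae_eq_integral_abs mu measurableT mf)[A [mA A0 sub]].
have AT : A = [set: borelType X].
  apply/seteqP; split => // x _; apply: sub => /= /(_ Logic.I) [fx].
  by have := flt0 x; rewrite fx ltxx.
have := probability_setT mu; rewrite -AT A0 => /eqP; by rewrite eq_sym onee_eq0.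
Qed.

End BorelIntegration.

(** * Suprema of mean-zero functions, and the design condition in terms of them *)

Section DesignProblem.
Context {R : realType} {X : ptopologicalType}.
Variables (mu : probability (borelType X) R) (W : set (X -> R^o)) (M : nat).
Hypothesis W_design : design_space W.
Hypothesis dimV : has_dim (mean_zero_space mu W) M.
Local Notation V := (mean_zero_space mu W).

Lemma bounded_funP (f : X -> R^o) : bounded_fun f -> exists B, forall x, `|f x| <= B.
Proof. by case=> B [_ fB]; exists (B + 1) => x; apply: fB => //; rewrite ltrDl. Qed.

Lemma mean_zero_bounded f : V f -> exists B : R, forall x, `|f x| <= B.
Proof.
case=> -[w Ww [c ->]] _; have [B wB] := bounded_funP (design_space_bounded W_design Ww).
by exists (B + `|c|) => x; rewrite (le_trans (ler_normD _ _)) // lerD.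
Qed.

Lemma mean_zero_continuous f : V f -> continuous f.
Proof.
case=> -[w Ww [c ->]] _; apply: continuous_addr; last exact: continuous_cstr.
exact: (design_space_continuous W_design Ww).
Qed.

Lemma mean_zero_lin a f g : V f -> V g -> V (a *: f + g).
Proof.
case: dimV => -[_ Vlin] _ Vf Vg.
by apply: set_mem; apply: Vlin; exact: mem_set.
Qed.

Lemma mean_zero0 : V 0.
Proof. by case: dimV => -[V0 _] _; exact: set_mem V0. Qed.

Lemma mean_zeroN f : V f -> V (- f).
Proof. by move=> Vf; rewrite -[- f]addr0 -scaleN1r; exact: mean_zero_lin mean_zero0. Qed.

Lemma mean_zero_comb (b : 'I_M -> X -> R^o) (c : 'I_M -> R) :
  (forall k, V (b k)) -> V (\sum_k c k *: b k).
Proof.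
move=> Vb; apply: big_ind => [|f g Vf Vg|k _]; first exact: mean_zero0.
- by rewrite -[f]scale1r; exact: mean_zero_lin.
- by rewrite -[_ *: _]addr0; exact: mean_zero_lin mean_zero0.
Qed.

Lemma mean_zero_exists_le0 f : V f -> exists x, f x <= 0.
Proof.
move=> Vf; have [||x fx] := @mean_zero_exists_ge0 R X mu (- f).
- exact: mean_zero_continuous (mean_zeroN Vf).
- by case: (mean_zeroN Vf).
by exists x; rewrite -oppr_ge0; exact: fx.
Qed.

Let Vsup f := sup (range (f : X -> R)).

Lemma mean_zero_has_sup f : V f -> has_sup (range (f : X -> R)).
Proof.
move=> /mean_zero_bounded[B fB]; split; first by exists (f point); exists point.
by exists B => _ [x _ <-]; rewrite (le_trans (ler_norm _)).
Qed.

Lemma mean_zero_le_sup f x : V f -> f x <= Vsup f.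
Proof. by move=> /mean_zero_has_sup[_ ub]; apply: ub_le_sup => //; exists x. Qed.

Lemma mean_zero_sup_ge0 f : V f -> 0 <= Vsup f.
Proof.
move=> Vf; have [|x fx] := @mean_zero_exists_ge0 R X mu f (mean_zero_continuous Vf).
  by case: Vf.
exact: le_trans fx (mean_zero_le_sup x Vf).
Qed.

(** The infimum of [f] is minus the supremum of [- f], which is nonnegative since [- f] has mean
    zero too; so the absolute value disappears. *)
Lemma design_constant_ge f : V f -> f != 0 ->
  ((Vsup f)%:E / (Vsup (- f))%:E <= design_constant mu W)%E.
Proof.
move=> Vf f0; apply: ereal_sup_ubound; exists f; first by split => //; exact/eqP.
have imE : [set (f x)%:E | x in [set: X]] = [set y%:E | y in range (f : X -> R)].
  by rewrite image_comp.
have supf := mean_zero_has_sup Vf.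
have supNf := mean_zero_has_sup (mean_zeroN Vf).
have NE : [set - y | y in range (f : X -> R)] = range ((- f) : X -> R).
  by rewrite image_comp.
rewrite imE ereal_sup_EFin ?ereal_inf_EFin //; try by case: supf.
  rewrite /= /inf NE normrN ger0_norm //; exact: mean_zero_sup_ge0 (mean_zeroN Vf).
apply/has_lb_ubN; rewrite NE; by case: supNf.
Qed.

Lemma design_constant_ge0 f : V f -> f != 0 -> (0 <= design_constant mu W)%E.
Proof.
move=> Vf f0; apply: le_trans (design_constant_ge Vf f0).
by apply: mule_ge0; rewrite ?inve_ge0 lee_fin mean_zero_sup_ge0 //; exact: mean_zeroN.
Qed.

(** The bound on the constant is applied to [- f]. If [f] had supremum 0, the ratio would be
    infinite by the convention on [0^-1], unless [- f] had supremum 0 as well, which forces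
    [f = 0]. *)
Lemma mean_zero_sup_bounds (K : R) f : (design_constant mu W <= K%:E)%E ->
  V f -> f != 0 -> 0 < Vsup f /\ (0 <= K /\ forall x, - f x <= K * Vsup f).
Proof.
move=> leK Vf f0; have VNf := mean_zeroN Vf.
have Nf0 : - f != 0 by rewrite oppr_eq0.
have sf := mean_zero_sup_ge0 Vf; have sNf := mean_zero_sup_ge0 VNf.
have H := le_trans (design_constant_ge VNf Nf0) leK; rewrite opprK in H.
have {}sf : 0 < Vsup f.
  rewrite lt_neqAle sf andbT eq_sym; apply/eqP => sfE; move: H; rewrite sfE inver eqxx.
  rewrite gt0_muley ?leye_eq // lte_fin lt_neqAle sNf andbT eq_sym; apply/eqP => sNfE.
  move: f0 => /eqP; apply; apply/funext => x; apply/eqP; rewrite eq_le.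
  have := mean_zero_le_sup x Vf; have := mean_zero_le_sup x VNf.
  by rewrite sfE sNfE /= oppr_le0 => -> ->.
move: H; rewrite inver gt_eqF // -EFinM lee_fin ler_pdivrMr // => sNfK.
split => //; split => [|x]; last exact: le_trans (mean_zero_le_sup x VNf) sNfK.
by rewrite -(pmulr_lge0 _ sf) (le_trans sNf).
Qed.

(** Subtracting from [w] its integral gives a mean-zero function, to which the hypothesis
    applies. *)
Lemma is_design_mean_zero N (p : 'I_N -> X) : (0 < N)%N ->
  (forall f, V f -> \sum_j f (p j) = 0) -> is_design mu W p.
Proof.
move=> N0 pV w Ww; have wc := design_space_continuous W_design Ww.
have [B wB] := bounded_funP (design_space_bounded W_design Ww).
have iw := continuous_bounded_integrable mu wc wB.
have /fineK wE := integrable_fin_num measurableT iw.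
set m := fine _ in wE.
have Vwm : V (w + cst (- m)).
  split; first by exists w => //; exists (- m).
  have -> : (\int[mu]_x ((w + cst (- m)) x)%:E =
     \int[mu]_x ((w x)%:E + (cst (- m)%:E) x))%E by [].
  rewrite integralD //; last exact: finite_measure_integrable_cst.
  have -> : (\int[mu]_x cst (- m)%:E x = (- m)%:E)%E.
    rewrite integral_cst // -[RHS]mule1; congr (_ * _)%E; exact: probability_setT.
  by rewrite -wE -EFinD subrr.
rewrite -wE; congr (_%:E); have := pV _ Vwm.
rewrite big_split /= sumr_const card_ord => /eqP.
rewrite addr_eq0 mulNrn opprK => /eqP ->.
by rewrite -[X in _ * X]mulr_natl mulKf // pnatr_eq0 -lt0n.
Qed.

End DesignProblem.

Theorem theorem4 (R : realType) (X : ptopologicalType)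
    (mu : probability (borelType X) R) (W : set (X -> R^o)) (M : nat)
    (W_design : design_space W)
    (X_path_connected : path_connected R X)
    (dimV : has_dim (mean_zero_space mu W) M)
    (M_gt0 : (0 < M)%N)
    (N : nat)
    (N_large : ((M%:R - 1)%:E * (design_constant mu W + 1) < N%:R%:E)%E) :
  exists p : 'I_N -> X, is_design mu W p.
Proof.
have [_ [b [Vb b_free b_span]]] := dimV.
have f_balanced N' (p : 'I_N' -> X) : (forall k, \sum_j b k (p j) = 0) ->
    forall f, mean_zero_space mu W f -> \sum_j f (p j) = 0.
  move=> bp f /b_span[c ->].
  under eq_bigr do rewrite fct_sumE.
  rewrite exchange_big big1 //= => k _.
  by rewrite -[LHS]/(\sum_j c k * b k (p j)) -mulr_sumr bp mulr0.
(* For M = 1 the hypothesis allows design_constant = +oo. *)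
have [M1|M2] := eqVneq M 1%N.
  subst M.
  (* Since [0 * +oo = 0], the bound reduces to [0 < N]. *)
  have N0 : (0 < N)%N by move: N_large; rewrite subrr mul0e lte_fin ltr0n.
  have bc := mean_zero_continuous W_design (Vb ord0).
  have [x0 x0P] := mean_zero_exists_ge0 bc (Vb ord0).2.
  have [x1 x1P] := mean_zero_exists_le0 W_design dimV (Vb ord0).
  have [gam [gc g0 g1]] := path_connected_continuous x1 x0 X_path_connected.
  (* A zero of the single basis function on a path from a nonpositive to a nonnegative value,
     repeated [N] times, is a design. *)
  have [||t _ bt] := @IVT R (fun t => b ord0 (gam t)) 0 1 0 ler01.
  - apply: continuous_subspaceT => t.
    by apply: (@continuous_comp _ _ _ gam (b ord0)); [exact: gc|exact: bc].
  - by rewrite g0 g1 ge_min x1P le_max x0P orbT.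
  exists (fun=> gam t); apply: (is_design_mean_zero W_design N0); apply: f_balanced => k.
  by rewrite ord1 big1.
have {M2}M2 : (1 < M)%N by rewrite ltn_neqAle eq_sym M2.
have M1 : 0 < M%:R - 1 :> R by rewrite subr_gt0 ltr1n.
have b_neq0 (c : 'I_M -> R) : (exists k, c k != 0) -> \sum_k c k *: b k != 0.
  by move=> [k ck]; apply: contra_neq ck => /b_free.
have [k0 _] : exists k0 : 'I_M, True by exists (Ordinal M_gt0).
have V_neq0 : b k0 != 0.
  have := b_neq0 (fun k => (k == k0)%:R).
  rewrite (bigD1 k0) //= eqxx scale1r big1 ?addr0.
    by apply; exists k0; rewrite eqxx oner_neq0.
  by move=> k /negPf->; rewrite scale0r.
(* As [M - 1] is positive, the value [+oo] would make the left side of [N_large] infinite;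
   nonnegativity excludes [-oo]. *)
have [K KE] : exists K, design_constant mu W = K%:E.
  have := design_constant_ge0 W_design dimV (Vb k0) V_neq0.
  case: (design_constant mu W) N_large => [K _ _|/=|].
  - by exists K.
  - by rewrite addye // gt0_muley ?lte_fin.
  - by move=> _; rewrite leNgt ltNy0.
have leK : (design_constant mu W <= K%:E)%E by rewrite KE.
have supK f := mean_zero_sup_bounds W_design dimV (f := f) leK.
have [_ [K0 _]] := supK _ (Vb k0) V_neq0.
have {}N_large : (M%:R - 1) * (K + 1) < N%:R.
  by move: N_large; rewrite KE -EFinD -EFinM lte_fin.
have N0 : (0 < N)%N.
  by rewrite -(ltr_nat R) (le_lt_trans _ N_large) // mulr_ge0 ?(ltW M1) ?addr_ge0.
have /choice[B bB] k : exists B : R, forall x, `|b k x| <= B.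
  by have [B fB] := mean_zero_bounded W_design (Vb k); exists B.
have bB' k x : `|b k x| <= \sum_i `|B i|.
  rewrite (le_trans (bB k x)) // (bigD1 k) //= (le_trans (ler_norm _)) // lerDl.
  by apply: sumr_ge0.
have combE (c : 'rV[R]_M) : comb (b : 'I_M -> X -> R) c = \sum_k c 0 k *: b k.
  by apply/funext => x; rewrite fct_sumE.
have comb_V (c : 'rV[R]_M) : mean_zero_space mu W (comb (b : 'I_M -> X -> R) c).
  by rewrite combE; exact: mean_zero_comb.
have comb_neq0 (c : 'rV[R]_M) : c != 0 -> comb (b : 'I_M -> X -> R) c != 0.
  by rewrite combE => /rV0Pn; exact: b_neq0.
have [||p pP] := @balanced_points R X M (b : 'I_M -> X -> R) _ K N X_path_connected
    (fun k => mean_zero_continuous W_design (Vb k)) bB' _ _ K0 M_gt0 N_large.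
- by move=> c /comb_neq0 c0; have [] := supK _ (comb_V c) c0.
- by move=> c x /comb_neq0 c0; have [_ [_]] := supK _ (comb_V c) c0; apply.
by exists p; apply: (is_design_mean_zero W_design N0); exact: f_balanced.
Qed.
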